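(* Consider the isentropic gas dynamics system on a 2-arc network (arcs $\ell$ and $r$), with the jump transmission condition with constant $\kappa>0$ at the junction, discretized by the finite volume scheme with HLL flux described in the context, with outer boundary conditions $$\rho^n_{0,\ell}=\rho^n_{1,\ell},\quad q^n_{0,\ell}=-q^n_{1,\ell},\qquad \rho^n_{J_r+1,r}=\rho^n_{J_r,r},\quad q^n_{J_r+1,r}=-q^n_{J_r,r},$$ and junction ghost states $U^{*,n}_\ell=(\rho^{*,n}_\ell,q^{*,n})$, $U^{*,n}_r=(\rho^{*,n}_r,q^{*,n})$ solving $$q^{*,n}=\kappa(\rho^{*,n}_\ell-\rho^{*,n}_r),$$ $$\frac{q^n_{J_\ell,\ell}+q^{*,n}}{2}-\frac{\lambda^n_\ell}{2}(\rho^{*,n}_\ell-\rho^n_{J_\ell,\ell})=q^{*,n},\qquad \frac{q^{*,n}+q^n_{1,r}}{2}-\frac{\lambda^n_r}{2}(\rho^n_{1,r}-\rho^{*,n}_r)=q^{*,n}.$$ Let $\lambda^n_\ell>0$ and $\lambda^n_r>0$ be such that $$\lambda^n_a\ \ge\ \max_{1\le j\le J_a}\left(|u^n_{j,a}|+\sqrt{p'(\rho^n_{j,a})}\right),\qquad a\in\{\ell,r\},$$ and let the time steps satisfy $\Delta t^n\le \Delta x/\max\{\lambda^n_\ell,\lambda^n_r\}$. If $\rho^0_{j,a}\ge 0$ for all $1\le j\le J_a$, $a\in\{\ell,r\}$, then $$\rho^n_{j,a}\ge 0\quad\text{for all }1\le j\le J_a,\ a\in\{\ell,r\},\ n\in\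mathbb{N}.$$
   Context: The system on each arc is $\partial_tU+\partial_xF(U)=0$, with $U=(\rho,q)$, $q=\rho u$ ($u$ the real-valued velocity), $F(U)=(\rho u,\ \rho u^2+p(\rho))$, $p(\rho)=p_0\rho^\gamma$, $p_0>0$, $\gamma>1$. The left arc $\ell$ is $[0,L_\ell]$ and the right arc $r$ is $[0,L_r]$; the junction is the point $x=L_\ell$ of arc $\ell$, identified with $x=0$ of arc $r$; the jump transmission condition is $q_\ell=q_r=\kappa(\rho_\ell-\rho_r)$ there. Scheme: arc $a\in\{\ell,r\}$ is divided into $J_a$ cells of equal length $\Delta x>0$ (the same for both arcs); $U^n_{j,a}=(\rho^n_{j,a},q^n_{j,a})$, with $q^n_{j,a}=\rho^n_{j,a}u^n_{j,a}$, is the approximate state in cell $j$ of arc $a$ at the $n$-th time step, and $\Delta t^n>0$ is the time step length. For $1\le j\le J_a$, $$U^{n+1}_{j,a}=U^n_{j,a}-\frac{\Delta t^n}{\Delta x}\left(\mathcal{F}^n_a(U^n_{j,a},U^n_{j+1,a})-\mathcal{F}^n_a(U^n_{j-1,a},U^n_{j,a})\right),$$ with the HLL numerical flux $$\mathcal{F}^n_a(U^-,U^+)=\frac{F(U^-)+F(U^+)}{2}-\frac{\lambda^n_a}{2}(U^+-U^-).$$ Ghost cells: $U^n_{0,\ell}$ and $U^n_{J_r+1,r}$ are the ghost states at the outer ends; at the junction $U^n_{J_\ell+1,\ell}=U^{*,n}_\ell$ and $U^n_{0,r}=U^{*,n}_r$. *)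

(* Defs.v *)
From mathcomp Require Import all_boot all_order all_algebra.
From mathcomp Require Import all_classical all_reals all_analysis.
Import Order.TTheory GRing.Theory Num.Theory.
Import numFieldNormedType.Exports.

Set Implicit Arguments.
Unset Strict Implicit.
Unset Printing Implicit Defensive.

Local Open Scope classical_set_scope.
Local Open Scope ring_scope.

Inductive network_arc := arc_l | arc_r.

(* A state U = (rho, q). *)
Definition state (R : realType) : Type := (R^o * R^o)%type.

(* p(rho) = p0 rho^gamma on rho >= 0. The value 0 at negative (non-physical)
   densities makes p differentiable at the vacuum state too, with p'(0) = 0
   (see pressure_is_derive); powR itself is 1 on negative arguments. *)
Definition pressure (R : realType) (p0 gamma : R) (rho : R) : R :=
  if 0 <= rho then p0 * rho `^ gamma else 0.

(* F(U) = (rho u, rho u^2 + p(rho)) in the variables (rho, q), with u = q / rho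
   and rho u = q. When rho = 0, division gives u = 0 and rho u^2 = 0. *)
Definition phys_flux (R : realType) (p0 gamma : R) (U : state R) : state R :=
  (U.2, U.1 * (U.2 / U.1) ^+ 2 + pressure p0 gamma U.1).

Definition hll_flux (R : realType) (p0 gamma lam : R) (Um Up : state R) :
    state R :=
  2^-1 *: (phys_flux p0 gamma Um + phys_flux p0 gamma Up)
  - (lam / 2) *: (Up - Um).

(* rho and q are indexed by arc, time step and cell. On an arc with J cells,
   the cells are 1, ..., J and the ghost cells are 0 and J + 1. *)
Definition cell_state (R : realType)
    (rho q : network_arc -> nat -> nat -> R)
    (a : network_arc) (n j : nat) : state R :=
  (rho a n j, q a n j).

Lemma pressure_is_derive (R : realType) (p0 gamma rho : R) :
  1 < gamma -> 0 <= rho ->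
  is_derive rho 1 (pressure p0 gamma) (p0 * (gamma * rho `^ (gamma - 1))).
Proof.
move=> g1; rewrite le_eqVlt => /orP[/eqP <-|r0]; last first.
  have near_p : \near rho, p0 * rho `^ gamma = pressure p0 gamma rho.
    near=> x; rewrite /pressure ifT//.
    by apply/ltW; near: x; exact: lt_nbhsr.
  apply: (near_eq_is_derive near_p).
  have dpow : is_derive (rho : R^o) 1 ((@powR R)^~ gamma : R^o -> R^o)
      (gamma * rho `^ (gamma - 1)) := is_derive1_powR gamma r0.
  exact: (@is_deriveZ _ _ _ _ p0 _ _ _ dpow).
have g10 : 0 < gamma - 1 by rewrite subr_gt0.
have g0 : 0 < gamma by rewrite (lt_trans _ g1).
rewrite powR0 ?gt_eqF// !mulr0.
pose Q (h : R) : R := h^-1 * (pressure p0 gamma (h *: 1 + 0)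
  - pressure p0 gamma 0).
have QE h : h != 0 -> Q h = if 0 < h then p0 * h `^ (gamma - 1) else 0.
  move=> hn0; rewrite /Q /pressure lexx powR0 ?gt_eqF// mulr0 subr0 addr0.
  rewrite [h *: 1]mulr1 le_eqVlt eq_sym (negbTE hn0)/=.
  case: ifPn => h0; last by rewrite mulr0.
  rewrite powRB; last by rewrite hn0 implybT.
  by rewrite powRr1 ?ltW// mulrC -mulrA.
have Q0 : Q h @[h --> 0^'] --> 0.
  apply: (@cvg_at_right_left_dnbhs _ R^o).
  - have : p0 * h `^ (gamma - 1) @[h --> 0^'+] --> p0 * 0.
      by apply: cvgM; [exact: cvg_cst|exact: powR_cvg0].
    rewrite mulr0; apply: cvg_trans; apply: near_eq_cvg; near=> h.
    have h0 : 0 < h by [].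
    by rewrite /= QE ?h0// gt_eqF.
  - have : (0 : R) @[h --> (0 : R)^'-] --> (0 : R) by exact: cvg_cst.
    apply: cvg_trans; apply: near_eq_cvg; near=> h.
    have h0 : h < 0 by [].
    by rewrite /= QE ?lt_eqF// ltNge ltW.
by apply: DeriveDef; [apply/cvg_ex; exists 0|apply: cvg_lim].
Unshelve. all: by end_near. Qed.

(* Main.v *)
Require Import Defs.
From mathcomp Require Import all_boot all_order all_algebra.
From mathcomp Require Import all_classical all_reals all_analysis.
From mathcomp Require Import ring lra.
Import Order.TTheory GRing.Theory Num.Theory.
Import numFieldNormedType.Exports.
Local Open Scope classical_set_scope.
Local Open Scope ring_scope.

(** Only the mass equation matters. With [nu = dt / dx] its update reads
    [rho_j' = (1 - nu lam) rho_j + nu/2 (lam rho_(j+1) - q_(j+1))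
              + nu/2 (lam rho_(j-1) + q_(j-1))]
    ([hll_mass_update]). The bound on [lam] gives [|q| <= lam rho] in every
    cell of nonnegative density, so in an interior cell all three terms are
    nonnegative. A reflecting wall swaps [lam rho + q] and [lam rho - q] of its
    neighbour, so it sends in a nonnegative contribution as well.

    At the junction the incoming term [lam_l rho*_l - q*] can be negative when
    [kappa] is large and [lam_r > lam_l], and the term [(1 - nu lam_l) rho]
    has to compensate for it. Put [A = lam_l rho_l + q_l] and
    [B = lam_r rho_r - q_r], both nonnegative. The two ghost equations say
    [lam_l rho*_l + q* = A] and [lam_r rho*_r - q* = B], and eliminating the
    ghost densities from the jump condition gives
    [(lam_l + lam_r) q* <= lam_r A] for every [kappa > 0]
    ([junction_flux_le]). Since [A <= 2 lam_l rho_l], the updated density is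
    nonnegative as soon as [2 lam_l nu q* <= A], and this follows from the
    bound on [q*] because [nu] times either speed is at most 1
    ([junction_cell_ge0]). Reversing the orientation, [q] to [- q], exchanges
    the two arcs, so the same two lemmas serve both sides. *)

(** The limit of an infinitely permeable junction, [kappa = +oo] and [B = 0],
    is the extremal case: there the bound is an equality. *)
Lemma junction_flux_le {R : realFieldType} {kappa l m A B x y s : R} :
  0 < kappa -> 0 < l -> 0 < m -> 0 <= A -> 0 <= B ->
  l * x + s = A -> m * y - s = B -> s = kappa * (x - y) ->
  (l + m) * s <= m * A.
Proof.
move=> k0 l0 m0 A0 B0 hx hy hs.
(* The jump condition multiplied by [l m], ghost densities eliminated. *)
have balance : l * m * s + kappa * ((l + m) * s - m * A) + kappa * (l * B) = 0.
  by rewrite -hx -hy [in l * m * s]hs; ring.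
rewrite leNgt; apply/negP => big.
have s0 : 0 < s.
  have lm0 : 0 < l + m by exact: addr_gt0.
  by rewrite -(pmulr_rgt0 _ lm0) (le_lt_trans _ big)// mulr_ge0// ltW.
have h1 : 0 < l * m * s by rewrite !mulr_gt0.
have h2 : 0 < kappa * ((l + m) * s - m * A) by rewrite mulr_gt0// subr_gt0.
have h3 : 0 <= kappa * (l * B) by rewrite !mulr_ge0// ltW.
lra.
Qed.

(** The ghost cell enters through [l * x - s], with [l * x + s] known; when this
    is negative it is the term [(1 - nu l) rho] that saves positivity. *)
Lemma junction_cell_ge0 {R : realFieldType} {nu l} m {rho q x s : R} :
  0 <= nu -> 0 < l -> 0 < m -> nu * l <= 1 -> nu * m <= 1 ->
  0 <= l * rho + q -> q <= l * rho ->
  l * x + s = l * rho + q -> (l + m) * s <= m * (l * rho + q) ->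
  0 <= (1 - nu * l) * rho + nu / 2 * (l * x - s).
Proof.
move=> nu0 l0 m0 nul num A0 qle hx.
have Arho : l * rho + q <= 2 * l * rho by lra.
have -> : l * x - s = (l * rho + q) - 2 * s by rewrite -hx; ring.
move: (l * rho + q) A0 Arho => A A0 Arho hs.
have key : 2 * l * (nu * s) <= A.
  have [s0|/ltW s0] := leP s 0.
    by apply: le_trans A0; rewrite mulr_ge0_le0 ?mulr_ge0 ?mulr_ge0_le0// ltW.
  have [lm|/ltW ml] := leP l m.
    have h1 : 0 <= (m - l) * (nu * s) by rewrite !mulr_ge0// subr_ge0.
    have h2 : 0 <= nu * (m * A - (l + m) * s) by rewrite mulr_ge0// subr_ge0.
    have h3 : 0 <= (1 - nu * m) * A by rewrite mulr_ge0// subr_ge0.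
    lra.
  have sA : 2 * s <= A.
    rewrite -(ler_pM2l m0); apply: le_trans hs.
    have h1 : 0 <= (l - m) * s by rewrite mulr_ge0// subr_ge0.
    lra.
  have h2 : 0 <= nu * l * (A - 2 * s) by rewrite !mulr_ge0 ?subr_ge0// ltW.
  have h3 : 0 <= (1 - nu * l) * A by rewrite mulr_ge0// subr_ge0.
  lra.
(* After multiplication by [2 l], replacing [2 l rho] by [A] leaves
   [A - 2 l nu s]. *)
have l2 : 0 < 2 * l by rewrite mulr_gt0.
rewrite -(pmulr_rge0 _ l2).
have h : 0 <= (1 - nu * l) * (2 * l * rho - A).
  by rewrite mulr_ge0// subr_ge0.
have -> : 2 * l * ((1 - nu * l) * rho + nu / 2 * (A - 2 * s)) =
  (1 - nu * l) * (2 * l * rho - A) + (A - 2 * l * (nu * s)) by field.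
by rewrite addr_ge0// subr_ge0.
Qed.

Lemma hll_mass_update {R : realType} {p0 gamma lam nu : R} {Ul U Ur V : state R} :
  V = U - nu *: (hll_flux p0 gamma lam U Ur - hll_flux p0 gamma lam Ul U) ->
  V.1 = (1 - nu * lam) * U.1 + nu / 2 * (lam * Ur.1 - Ur.2)
        + nu / 2 * (lam * Ul.1 + Ul.2).
Proof.
move=> ->.
have -> : (U - nu *: (hll_flux p0 gamma lam U Ur
                      - hll_flux p0 gamma lam Ul U)).1 =
  U.1 - nu * ((2^-1 * (U.2 + Ur.2) - lam / 2 * (Ur.1 - U.1))
            - (2^-1 * (Ul.2 + U.2) - lam / 2 * (U.1 - Ul.1))) by [].
by field.
Qed.

(** The sound speed only enlarges the bound on the velocity, so [lam] dominates
    the velocity itself. *)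
Lemma momentum_le_of_speed {R : realType} {u c rho q : nat -> R} {lam : R}
    {J j : nat} :
  \big[Num.max/0]_(1 <= i < J.+1) (`|u i| + Num.sqrt (c i)) <= lam ->
  (1 <= j <= J)%N -> q j = rho j * u j -> 0 <= rho j ->
  0 <= lam * rho j + q j /\ 0 <= lam * rho j - q j.
Proof.
move=> hmax /andP[j1 jJ] -> r0.
have ul : `|u j| <= lam.
  apply: le_trans hmax; apply: le_trans (_ : `|u j| + Num.sqrt (c j) <= _).
    by rewrite lerDl sqrtr_ge0.
  by apply: (le_bigmax_seq _ j) => //; rewrite mem_index_iota j1.
move: ul; rewrite ler_norml => /andP[ul1 ul2].
have h1 : 0 <= rho j * (u j + lam) by rewrite mulr_ge0// -lerBlDr sub0r.
have h2 : 0 <= rho j * (lam - u j) by rewrite mulr_ge0// subr_ge0.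
by split; lra.
Qed.

Theorem proposition4p2 (R : realType) (p0 gamma kappa dx : R)
    (L : network_arc -> R) (J : network_arc -> nat)
    (rho q u : network_arc -> nat -> nat -> R)
    (rhostar : network_arc -> nat -> R) (qstar : nat -> R)
    (lam : network_arc -> nat -> R) (dt : nat -> R)
    (hp0 : 0 < p0) (hgamma : 1 < gamma) (hkappa : 0 < kappa)
    (hdx : 0 < dx) (hJ : forall a, (0 < J a)%N)
    (hL : forall a, L a = (J a)%:R * dx)
    (hdt : forall n, 0 < dt n)
    (hlam : forall a n, 0 < lam a n)
    (hvelocity : forall a n j, (1 <= j <= J a)%N ->
       q a n j = rho a n j * u a n j)
    (hscheme : forall a n j, (1 <= j <= J a)%N ->
       cell_state rho q a n.+1 j =
       cell_state rho q a n j
       - (dt n / dx) *: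
         (hll_flux p0 gamma (lam a n)
            (cell_state rho q a n j) (cell_state rho q a n j.+1)
          - hll_flux p0 gamma (lam a n)
              (cell_state rho q a n j.-1) (cell_state rho q a n j)))
    (houter_l : forall n,
       rho arc_l n 0%N = rho arc_l n 1%N /\ q arc_l n 0%N = - q arc_l n 1%N)
    (houter_r : forall n,
       rho arc_r n (J arc_r).+1 = rho arc_r n (J arc_r) /\
       q arc_r n (J arc_r).+1 = - q arc_r n (J arc_r))
    (hghost_l : forall n,
       cell_state rho q arc_l n (J arc_l).+1 = (rhostar arc_l n, qstar n))
    (hghost_r : forall n,
       cell_state rho q arc_r n 0%N = (rhostar arc_r n, qstar n))
    (hjump : forall n, qstar n = kappa * (rhostar arc_l n - rhostar arc_r n))
    (hmass_l : forall n,
       (q arc_l n (J arc_l) + qstar n) / 2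
       - lam arc_l n / 2 * (rhostar arc_l n - rho arc_l n (J arc_l)) = qstar n)
    (hmass_r : forall n,
       (qstar n + q arc_r n 1%N) / 2
       - lam arc_r n / 2 * (rho arc_r n 1%N - rhostar arc_r n) = qstar n)
    (hspeed : forall a n,
       \big[Num.max/0]_(1 <= j < (J a).+1)
          (`|u a n j| + Num.sqrt (derive1 (pressure p0 gamma) (rho a n j)))
       <= lam a n)
    (hcfl : forall n, dt n <= dx / Num.max (lam arc_l n) (lam arc_r n))
    (hinit : forall a j, (1 <= j <= J a)%N -> 0 <= rho a 0%N j) :
  forall a n j, (1 <= j <= J a)%N -> 0 <= rho a n j.
Proof.
move=> a n; elim: n a => [|n IH] a j jJ; first exact: hinit.
set nu := dt n / dx.
have nu0 : 0 <= nu by rewrite divr_ge0// ltW.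
have cfl b : nu * lam b n <= 1.
  have M0 : 0 < Num.max (lam arc_l n) (lam arc_r n) by rewrite lt_max hlam.
  have nuM : nu * Num.max (lam arc_l n) (lam arc_r n) <= 1.
    have := hcfl n; rewrite ler_pdivlMr// => h.
    by rewrite /nu mulrAC ler_pdivrMr// mul1r.
  apply: le_trans nuM; apply: ler_wpM2l => //.
  by case: b; rewrite le_max lexx ?orbT.
have waves b i : (1 <= i <= J b)%N ->
    0 <= lam b n * rho b n i + q b n i /\ 0 <= lam b n * rho b n i - q b n i.
  move=> iJ.
  exact: momentum_le_of_speed (hspeed b n) iJ (hvelocity b n i iJ) (IH b i iJ).
have := hll_mass_update (hscheme a n j jJ).
rewrite /= -/nu => ->.
have nu2 : 0 <= nu / 2 by rewrite divr_ge0.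
have kept : 0 <= (1 - nu * lam a n) * rho a n j.
  by rewrite mulr_ge0 ?subr_ge0 ?cfl ?IH.
have last_l : (1 <= J arc_l <= J arc_l)%N by rewrite hJ leqnn.
have first_r : (1 <= 1 <= J arc_r)%N by rewrite hJ.
have [A0 A0'] := waves arc_l _ last_l.
have [B0' B0] := waves arc_r _ first_r.
have ghost_l : lam arc_l n * rhostar arc_l n + qstar n =
    lam arc_l n * rho arc_l n (J arc_l) + q arc_l n (J arc_l).
  by have := hmass_l n; lra.
have ghost_r : lam arc_r n * rhostar arc_r n - qstar n =
    lam arc_r n * rho arc_r n 1%N - q arc_r n 1%N.
  by have := hmass_r n; lra.
case: a jJ kept => /andP[j1 jJ] kept.
- have from_left : 0 <= lam arc_l n * rho arc_l n j.-1 + q arc_l n j.-1.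
    case: j j1 jJ kept => [//|[|i]] _ iJ _ /=.
      have [-> ->] := houter_l n.
      by have [_] := waves arc_l 1%N iJ.
    by have [] := waves arc_l i.+1 (ltnW iJ).
  apply: addr_ge0; last exact: mulr_ge0.
  have [jlt|jge] := ltnP j (J arc_l).
    apply: addr_ge0 => //; apply: mulr_ge0 => //.
    by have [] := waves arc_l j.+1 jlt.
  have -> : j = J arc_l by apply/eqP; rewrite eqn_leq jJ.
  case: (hghost_l n) => -> ->.
  apply: (junction_cell_ge0 (lam arc_r n) (q := q arc_l n (J arc_l))) => //.
    by rewrite -subr_ge0.
  exact: junction_flux_le hkappa _ _ A0 B0 ghost_l ghost_r (hjump n).
- have from_right : 0 <= lam arc_r n * rho arc_r n j.+1 - q arc_r n j.+1.
    have [jlt|jge] := ltnP j (J arc_r).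
      by have [] := waves arc_r j.+1 jlt.
    have -> : j = J arc_r by apply/eqP; rewrite eqn_leq jJ.
    have [-> ->] := houter_r n; rewrite opprK.
    by have [] := waves arc_r (J arc_r); rewrite ?hJ ?leqnn.
  rewrite addrAC; apply: addr_ge0; last exact: mulr_ge0.
  case: j j1 jJ kept {from_right} => [//|[|i]] _ iJ kept /=; last first.
    apply: addr_ge0 => //; apply: mulr_ge0 => //.
    by have [] := waves arc_r i.+1 (ltnW iJ).
  case: (hghost_r n) => -> ->.
  (* Mirror image: all momenta change sign and the arcs trade places. *)
  rewrite -[qstar n]opprK.
  apply: (junction_cell_ge0 (lam arc_l n) (q := - q arc_r n 1%N)) => //.
    by rewrite -subr_ge0 opprK.
  apply: (junction_flux_le (x := rhostar arc_r n) (y := rhostar arc_l n)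
            hkappa _ _ B0 A0) => //.
    by rewrite opprK.
  by rewrite [in LHS]hjump; ring.
Qed.
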